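(* Let $\nu\in\mathcal{P}_\theta$ satisfy (MGF--CI) with some constant $c_\nu>0$, i.e. for all $\alpha^2,\beta>0$, all $\lambda>0$ and every bounded local function $F:\Omega\to\mathbb{R}$ with $D_xF\le\beta$ $(\nu\otimes dx)$-a.s. and $\int_{\mathbb{R}^d}|D_xF|^2\,dx\le\alpha^2$ $\nu$-a.s., $$\nu\big[e^{\lambda(F-\nu[F])}\big]\le\exp\Big\{c_\nu\,\alpha^2\,\lambda\,\frac{e^{\beta\lambda}-1}{\beta}\Big\}.$$ Then $\mathscr{I}(\mu\,|\,\nu)>0$ for all $\mu\in\mathcal{P}_\theta\setminus\{\nu\}$.
   Context: $\Omega$ is the set of simple locally finite counting measures (point configurations) on $\mathbb{R}^d$, each identified with its support. $\mathcal{F}$ is the $\sigma$-algebra on $\Omega$ generated by the counting variables $N_\Lambda(\omega)=\#(\omega\cap\Lambda)$, for $\Lambda\Subset\mathbb{R}^d$, meaning $\Lambda\subseteq\mathbb{R}^d$ bounded and Borel. For $\Lambda\subseteq\mathbb{R}^d$, $\eta_\Lambda=\eta\cap\Lambda$. $\mathcal{F}_\Lambda$ is the sub-$\sigma$-algebra generated by $N_\Delta$, $\Delta\Subset\mathbb{R}^d$, $\Delta\subseteq\Lambda$, and $\mu_\Lambda$ is the restriction of a probability measure $\mu$ to $\mathcal{F}_\Lambda$. Translations act by $\theta_x\omega=\sum_i\delta_{x_i-x}$ for $\omega=\sum_i\delta_{x_i}$, and $\mathcal{P}_\theta$ is the set of probability measures on $(\Omega,\mathcal{F})$ invariant under all $\theta_x$,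 $x\in\mathbb{R}^d$. A measurable function $F:\Omega\to\mathbb{R}$ is local if there is $\Lambda\Subset\mathbb{R}^d$ with $F(\eta)=F(\eta_\Lambda)$ for all $\eta$. $\nu[F]$ denotes the expectation of $F$ under $\nu$. Discrete gradient: $(D_xF)(\eta)=F(\eta+\delta_x)-F(\eta)$, defined for $x\notin\eta$ (for given $\eta$ this excludes only a Lebesgue-null set of $x$). Relative entropy: $I(P\,|\,Q)=Q[f\log f]$ if the density $f=dP/dQ$ exists, and $I(P\,|\,Q)=\infty$ otherwise. With $\Lambda_n=[-n,n]^d$ and $|\cdot|$ Lebesgue measure, the specific relative entropy is $\mathscr{I}(\mu\,|\,\nu)=\liminf_{n\to\infty}\frac{1}{|\Lambda_n|}I(\mu_{\Lambda_n}\,|\,\nu_{\Lambda_n})$, which is the limit whenever the limit exists. *)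

(* Defs.v *)
From HB Require Import structures.
From mathcomp Require Import all_boot all_order all_algebra finmap.
From mathcomp Require Import all_classical all_reals all_analysis.
From mathcomp Require Import measurable_realfun.

Set Implicit Arguments.
Unset Strict Implicit.
Unset Printing Implicit Defensive.
Import Order.TTheory GRing.Theory Num.Theory.
Import numFieldNormedType.Exports.
Local Open Scope classical_set_scope.
Local Open Scope ring_scope.

Definition borel_rV_display : measure_display.
Proof. exact: default_measure_display. Qed.

HB.instance Definition _ (R : realType) (d : nat) :=
  @isMeasurable.Build borel_rV_display 'rV[R]_d
    <<s @open 'rV[R]_d >> (@sigma_algebra0 _ setT (@open 'rV[R]_d))
    (@sigma_algebraC _ (@open 'rV[R]_d))
    (@sigma_algebra_bigcup _ setT (@open 'rV[R]_d)).

Section borel_rV.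
Context (R : realType).

Lemma measurable_rV_coord d (i : 'I_d) :
  measurable_fun [set: 'rV[R]_d] (fun v : 'rV[R]_d => v 0 i).
Proof.
apply: (measurability (@RGenOInfty.G R) (RGenOInfty.measurableE R)).
move=> _ [_ [a ->] <-]; rewrite setTI.
apply: sub_sigma_algebra.
apply: (@open_comp _ _ (fun v : 'rV[R]_d => v 0 i)); last exact: interval_open.
by move=> x _; exact: coord_continuous.
Qed.

Lemma open_rV_bigcup d (U : set 'rV[R]_d) : open U ->
  U = \bigcup_(p in [set p : 'rV[rat]_d * nat |
        forall x : 'rV[R]_d,
          (forall i, `|ratr (p.1 0 i) - x 0 i| < p.2.+1%:R^-1) -> U x])
      \bigcap_(i in [set: 'I_d])
        [set x | `|ratr (p.1 0 i) - x 0 i| < p.2.+1%:R^-1].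
Proof.
move=> oU; apply/seteqP; split=> [x Ux|x [[q n] /= H Hx]]; last first.
  by apply: H => i; exact: Hx.
have /nbhs_ballP[e /= e0 eU] : nbhs x U by exact: open_nbhs_nbhs.
pose n := Num.truncn (2 / e).
have n1e : n.+1%:R^-1 < e / 2.
  rewrite -[e / 2]invf_div ltf_pV2 ?posrE ?divr_gt0 ?ltr0n//.
  exact: truncnS_gt.
have {}n1e : n.+1%:R^-1 + n.+1%:R^-1 < e by rewrite [e]splitr ltrD.
have qE i : exists q : rat, `|ratr q - x 0 i| < n.+1%:R^-1.
  have /rat_in_itvoo[q /itvP qx] : x 0 i < x 0 i + n.+1%:R^-1 :> R.
    by rewrite ltrDl invr_gt0 ltr0n.
  exists q; rewrite ltr_norml; apply/andP; split.
    by rewrite (@lt_le_trans _ _ 0) ?subr_ge0 ?oppr_lt0 ?invr_gt0 ?ltr0n ?qx.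
  by rewrite ltrBlDl qx.
have [f fE] := choice qE.
exists (\row_i f i, n) => /=; last by move=> i _ /=; rewrite mxE.
move=> y Hy; apply: eU; split => // j i; rewrite (ord1 j).
rewrite /ball /= -(subrKA (ratr (f i))) (le_lt_trans (ler_normD _ _))//.
apply: lt_trans n1e; rewrite ltrD//; first by rewrite distrC.
by have := Hy i; rewrite mxE.
Qed.

Lemma measurable_fun_rVP d dT (T : measurableType dT) (f : T -> 'rV[R]_d) :
  (forall i, measurable_fun [set: T] (fun t => f t 0 i)) ->
  measurable_fun [set: T] f.
Proof.
move=> mf; apply: (measurability (@open 'rV[R]_d) erefl) => _ [U oU <-]; rewrite setTI.
rewrite (open_rV_bigcup oU) preimage_bigcup.
rewrite bigcup_mkcond; apply: countable_bigcupT_measurable => // -[q n].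
case: ifPn => // _.
rewrite preimage_bigcap; apply: fin_bigcap_measurable => // i _.
have -> : f @^-1` [set x | `|ratr (q 0 i) - x 0 i| < n.+1%:R^-1] =
    (fun t => f t 0 i) @^-1` (ball (ratr (q 0 i) : R) n.+1%:R^-1) by [].
rewrite -[X in measurable X]setTI; apply: mf => //.
exact: measurable_ball.
Qed.

End borel_rV.

Section lebesgue_rV.
Context (R : realType).

Section step.
Variable d : nat.
Variable m : {sigma_finite_measure set 'rV[R]_d -> \bar R}.

Definition cons_rV (p : measurableTypeR R * 'rV[R]_d) : 'rV[R]_d.+1 :=
  \row_(i < d.+1) (if unlift ord0 i is Some j then p.2 0 j else p.1).

Definition uncons_rV (v : 'rV[R]_d.+1) : measurableTypeR R * 'rV[R]_d :=
  (v 0 ord0, \row_(j < d) v 0 (lift ord0 j)).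

Lemma cons_rVK : cancel cons_rV uncons_rV.
Proof.
move=> [x v]; congr pair; first by rewrite mxE unlift_none.
by apply/rowP => j; rewrite !mxE liftK.
Qed.

Lemma uncons_rVK : cancel uncons_rV cons_rV.
Proof.
move=> v; apply/rowP => i; rewrite mxE.
by case: unliftP => [j|] -> //=; rewrite mxE.
Qed.

Lemma measurable_cons_rV : measurable_fun [set: measurableTypeR R * 'rV[R]_d] cons_rV.
Proof.
apply: measurable_fun_rVP => i.
rewrite (_ : (fun _ => _) = fun p : measurableTypeR R * 'rV[R]_d =>
    if unlift ord0 i is Some j then p.2 0 j else p.1); last first.
  by apply/funext => p; rewrite mxE.
case: unlift => [j|]; last exact: measurable_fst.
exact: (measurableT_comp (measurable_rV_coord j) measurable_snd).
Qed.

Lemma measurable_uncons_rV : measurable_fun [set: 'rV[R]_d.+1] uncons_rV.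
Proof.
apply/measurable_fun_pairP; split; first exact: measurable_rV_coord.
apply: measurable_fun_rVP => j.
rewrite (_ : (fun _ => _) = fun v : 'rV[R]_d.+1 => v 0 (lift ord0 j)).
  exact: measurable_rV_coord.
by apply/funext => v /=; rewrite mxE.
Qed.

Definition lebesgue_rV_step : set 'rV[R]_d.+1 -> \bar R :=
  pushforward (lebesgue_measure \x m)%E cons_rV.

Let step0 : lebesgue_rV_step set0 = 0%E.
Proof. by rewrite /lebesgue_rV_step /pushforward preimage_set0 measure0. Qed.

Let step_ge0 A : (0 <= lebesgue_rV_step A)%E.
Proof. by rewrite /lebesgue_rV_step /pushforward; exact: measure_ge0. Qed.

Let step_sigma_additive : semi_sigma_additive lebesgue_rV_step.
Proof.
move=> F mF tF mUF; rewrite /lebesgue_rV_step /pushforward preimage_bigcup.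
have mcF n : measurable (cons_rV @^-1` F n).
  by rewrite -[X in measurable X]setTI; exact: measurable_cons_rV.
apply: measure_semi_sigma_additive => //; last exact: bigcupT_measurable.
apply/trivIsetP => i j _ _ ij; rewrite -preimage_setI.
by move/trivIsetP : tF => /(_ _ _ _ _ ij) ->//; rewrite preimage_set0.
Qed.

HB.instance Definition _ := isMeasure.Build _ _ _ lebesgue_rV_step
  step0 step_ge0 step_sigma_additive.

Let step_sigma_finite : sigma_finite [set: 'rV[R]_d.+1] lebesgue_rV_step.
Proof.
have /sigma_finiteP[F [TF ndF Foo]] := sigma_finiteT (@lebesgue_measure R).
have /sigma_finiteP[G [TG ndG Goo]] := sigma_finiteT m.
exists (fun n => uncons_rV @^-1` (F n `*` G n)).
  rewrite -preimage_bigcup (_ : \bigcup_i _ = setT) ?preimage_setT//.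
  apply/seteqP; split=> // -[x v] _.
  have [n _ Fx] : (\bigcup_i F i) x by rewrite -TF.
  have [k _ Gv] : (\bigcup_i G i) v by rewrite -TG.
  exists (maxn n k) => //; split => /=.
    by move: x Fx; exact/subsetPset/ndF/leq_maxl.
  by move: v Gv; exact/subsetPset/ndG/leq_maxr.
move=> n; have [mF Fn] := Foo n; have [mG Gn] := Goo n; split.
  rewrite -[X in measurable X]setTI; apply: measurable_uncons_rV => //.
  exact: measurableX.
rewrite /lebesgue_rV_step /pushforward -comp_preimage.
rewrite (_ : uncons_rV \o cons_rV = id); last exact/funext/cons_rVK.
by rewrite preimage_id product_measure1E// lte_mul_pinfty// ge0_fin_numE.
Qed.

HB.instance Definition _ := Measure_isSigmaFinite.Build _ _ _ lebesgue_rV_step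
  step_sigma_finite.

End step.

Fixpoint lebesgue_rV (d : nat) : {sigma_finite_measure set 'rV[R]_d -> \bar R} :=
  if d is d'.+1 then lebesgue_rV_step (lebesgue_rV d')
  else \d_(0 : 'rV[R]_0).

Lemma lebesgue_rV_box d (a b : 'I_d -> R) : (forall i, a i <= b i) ->
  lebesgue_rV d [set x | forall i, a i <= x 0 i <= b i] =
  (\prod_(i < d) (b i - a i))%:E.
Proof.
elim: d a b => [|d IHd] a b ab.
  by rewrite big_ord0 /= diracE mem_set// => -[].
rewrite big_ord_recl EFinM -(IHd (a \o lift ord0) (b \o lift ord0)); last first.
  by move=> i; exact: ab.
rewrite [LHS]/= /lebesgue_rV_step /pushforward.
rewrite (_ : _ @^-1` _ = `[a ord0, b ord0]%classic `*`
    [set x : 'rV[R]_d | forall i, a (lift ord0 i) <= x 0 i <= b (lift ord0 i)]).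
  rewrite product_measure1E//; last first.
    rewrite (_ : [set _ | _] = \bigcap_(i in [set: 'I_d]) ((fun x : 'rV[R]_d =>
        x 0 i) @^-1` `[a (lift ord0 i), b (lift ord0 i)]%classic)).
      apply: fin_bigcap_measurable => // i _; rewrite -[X in measurable X]setTI.
      exact: measurable_rV_coord.
    apply/seteqP; split=> x /= H i.
      by move=> _ /=; rewrite in_itv/=; exact: H.
    by have := H i Logic.I; rewrite /= in_itv.
  congr mule; apply: (eq_trans (lebesgue_measure_itv `[a ord0, b ord0])).
  rewrite /= lte_fin; have := ab ord0; rewrite le_eqVlt => /predU1P[->|->].
    by rewrite ltxx subrr.
  by rewrite EFinB.
apply/seteqP; split=> -[x v] /=.
  move=> H; split => [|i]; first by have := H ord0; rewrite mxE unlift_none in_itv.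
  by have := H (lift ord0 i); rewrite mxE liftK.
rewrite in_itv/= => -[xab H] i; rewrite mxE.
by case: unliftP => [j|] -> //=; exact: H.
Qed.

End lebesgue_rV.

Definition config_display : measure_display.
Proof. exact: default_measure_display. Qed.

Section configurations.
Context (R : realType) (d : nat).

Definition locally_finite (A : set 'rV[R]_d) : Prop :=
  forall B, bounded_set B -> finite_set (A `&` B).

(* A simple locally finite counting measure, identified with its support. *)
Record config := Config {
  support :> set 'rV[R]_d ;
  config_locally_finite : locally_finite support }.

Lemma config_eq (omega eta : config) : support omega = support eta -> omega = eta.
Proof.
case: omega eta => [A hA] [B hB] /= AB; move: hA hB; rewrite AB => hA hB.
by congr Config; exact: Prop_irrelevance.
Qed.

Lemma locally_finite0 : locally_finite set0.
Proof. by move=> B _; rewrite set0I. Qed.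

HB.instance Definition _ := gen_eqMixin config.
HB.instance Definition _ := gen_choiceMixin config.
HB.instance Definition _ := isPointed.Build config (Config locally_finite0).

Definition counting_var (Lam : set 'rV[R]_d) (omega : config) : nat :=
  #|` fset_set (omega `&` Lam)|.

Definition counting_events (Lam : set 'rV[R]_d) : set (set config) :=
  [set E | exists Delta : set 'rV[R]_d, exists B : set nat,
    [/\ bounded_set Delta, measurable Delta, Delta `<=` Lam &
        E = counting_var Delta @^-1` B]].

HB.instance Definition _ :=
  @isMeasurable.Build config_display config
    <<s counting_events setT >> (@sigma_algebra0 _ setT (counting_events setT))
    (@sigma_algebraC _ (counting_events setT))
    (@sigma_algebra_bigcup _ setT (counting_events setT)).

Definition config_on (Lam : set 'rV[R]_d) :=
  g_sigma_algebraType (counting_events Lam).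

HB.instance Definition _ Lam := Measurable.on (config_on Lam).

Lemma locally_finite_restrict (Lam : set 'rV[R]_d) (omega : config) :
  locally_finite (omega `&` Lam).
Proof.
move=> B /(config_locally_finite omega).
by apply: sub_finite_set => x [[]].
Qed.

Definition config_restrict (Lam : set 'rV[R]_d) (omega : config) : config :=
  Config (locally_finite_restrict Lam omega).

Lemma locally_finite_add (x : 'rV[R]_d) (omega : config) :
  locally_finite (x |` omega).
Proof.
move=> B /(config_locally_finite omega) fB.
rewrite setIUl finite_setU; split=> //.
exact: sub_finite_set (@subIsetl _ _ _) _.
Qed.

Definition config_add (x : 'rV[R]_d) (omega : config) : config :=
  Config (locally_finite_add x omega).

Lemma locally_finite_translate (x : 'rV[R]_d) (omega : config) :
  locally_finite ((fun y => y - x) @` omega).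
Proof.
move=> B [M [Mr HM]].
have : bounded_set ((fun y => y + x) @` B).
  exists (M + `|x|); split; first by rewrite num_real.
  move=> r Mr' _ [y By <-] /=; rewrite (le_trans (ler_normD _ _))// -lerBrDr.
  by apply: HM => //; rewrite ltrBrDr.
move=> /(config_locally_finite omega) fB.
apply: sub_finite_set (finite_image (fun y => y - x) fB).
move=> _ [[y oy <-] Byx]; exists y => //; split => //.
by exists (y - x) => //; rewrite subrK.
Qed.

Definition config_translate (x : 'rV[R]_d) (omega : config) : config :=
  Config (locally_finite_translate x omega).

Definition stationary (mu : probability config R) : Prop :=
  forall (x : 'rV[R]_d) (A : set config), measurable A ->
    mu (config_translate x @^-1` A) = mu A.

Definition is_local (F : config -> R) : Prop :=
  measurable_fun setT F /\
  exists Lam : set 'rV[R]_d, [/\ bounded_set Lam, measurable Lam &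
    forall eta, F eta = F (config_restrict Lam eta)].

(* The gradient is only meaningful for x outside eta; for x in eta, a countable
   hence Lebesgue-null set, the definition below returns 0. *)
Definition gradient (x : 'rV[R]_d) (F : config -> R) (eta : config) : R :=
  F (config_add x eta) - F eta.

Definition MGF_CI (c : R) (nu : probability config R) : Prop :=
  forall (alpha beta lambda : R) (F : config -> R),
    0 < alpha ^+ 2 -> 0 < beta -> 0 < lambda ->
    is_local F -> bounded_fun F ->
    {ae (nu \x lebesgue_rV R d)%E, forall p, gradient p.2 F p.1 <= beta} ->
    {ae nu, forall eta,
      (\int[lebesgue_rV R d]_x (`|gradient x F eta| ^+ 2)%:E <=
        (alpha ^+ 2)%:E)%E} ->
    ('E_nu[fun eta => expR (lambda * (F eta - fine 'E_nu[F]))] <=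
     (expR (c * alpha ^+ 2 * lambda * ((expR (beta * lambda) - 1) / beta)))%:E)%E.

Section restriction.
Variables (Lam : set 'rV[R]_d) (mu : probability config R).

Lemma sub_counting_events :
  @measurable _ (config_on Lam) `<=` @measurable _ config.
Proof.
apply: sub_sigma_algebra2 => _ [D [B [bD mD _ ->]]].
by exists D, B; split.
Qed.

Definition measure_restrict : set (config_on Lam) -> \bar R := fun A => mu A.

Let restr0 : measure_restrict set0 = 0%E.
Proof. exact: measure0. Qed.

Let restr_ge0 A : (0 <= measure_restrict A)%E.
Proof. exact: measure_ge0. Qed.

Let restr_sigma_additive : semi_sigma_additive measure_restrict.
Proof.
move=> F mF tF mUF; apply: measure_semi_sigma_additive => //.
- by move=> n; exact: sub_counting_events.
- exact: sub_counting_events.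
Qed.

HB.instance Definition _ := isMeasure.Build _ _ _ measure_restrict
  restr0 restr_ge0 restr_sigma_additive.

Let restr_setT : measure_restrict setT = 1%E.
Proof. exact: probability_setT. Qed.

HB.instance Definition _ := Measure_isProbability.Build _ _ _ measure_restrict
  restr_setT.

End restriction.

End configurations.
Arguments measure_restrict {R d} Lam mu.

Definition is_density dT (T : measurableType dT) (R : realType)
    (P Q : probability T R) (f : T -> R) : Prop :=
  [/\ measurable_fun setT f, forall x, 0 <= f x &
      forall A, measurable A -> P A = (\int[Q]_(x in A) (f x)%:E)%E].

(* The density is unique up to Q-null sets, so the choice below is immaterial;
   since [ln 0 = 0], the integrand vanishes where f does. *)
Definition relative_entropy dT (T : measurableType dT) (R : realType)
    (P Q : probability T R) : \bar R :=
  match pselect (exists f, is_density P Q f) with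
  | left ex => let f := sval (cid ex) in (\int[Q]_x (f x * ln (f x))%:E)%E
  | right _ => +oo%E
  end.

Definition cube (R : realType) (d n : nat) : set 'rV[R]_d :=
  [set x | forall i, - n%:R <= x 0 i <= n%:R].
Arguments cube : clear implicits.

(* The term n = 0, where the cube has volume 0, does not affect the liminf. *)
Definition specific_entropy (R : realType) (d : nat)
    (mu nu : probability (config R d) R) : \bar R :=
  limn_einf (fun n =>
    relative_entropy (measure_restrict (cube R d n) mu)
                     (measure_restrict (cube R d n) nu)
    / lebesgue_rV R d (cube R d n))%E.

(* Main.v *)
Require Import Defs.
From HB Require Import structures.
From mathcomp Require Import all_boot all_order all_algebra finmap.
From mathcomp Require Import all_classical all_reals all_analysis.
From mathcomp Require Import measurable_realfun zify ring lra.

(** If [mu] and [nu] differ, they differ on an event [A] that depends on the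
configuration in some cube [C] only, say [mu A - nu A = delta > 0]
([exists_local_event_gt]). The cube of index [n] contains a number of disjoint
translates of [C] proportional to its volume. Let [F] count the translates of
[A] that occur in these translates of [C]. By stationarity the means of [F]
under [mu] and [nu] differ by [delta] times the number of translates: a
difference of the order of the volume.

Since the translates of [C] are disjoint, adding a point changes [F] by at most
1, and the squared norm of its gradient is at most the total volume of the
translates ([integral_gradient_event_count]). The concentration inequality
therefore bounds the logarithm of the exponential moment of [lambda * F],
centred under [nu], by a term of order [lambda ^+ 2] times the volume. The
variational lower bound for the relative entropy ([gibbs_inequality]) says that
the entropy in the cube is at least the mean of this centred variable under
[mu] minus that logarithm, that is, at least the volume times
[kappa * lambda * (delta - O(lambda))] for some [kappa > 0]
([entropy_ge_event_count], [entropy_ge_lattice]). For [lambda] small and fixed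
this is a positive multiple of the volume, uniformly for large [n]. *)

Set Implicit Arguments.
Unset Strict Implicit.
Unset Printing Implicit Defensive.
Import Order.TTheory GRing.Theory Num.Theory.
Import numFieldNormedType.Exports.
Local Open Scope classical_set_scope.
Local Open Scope ring_scope.

(** * A variational lower bound for relative entropy *)

(** Both parts of the definition of the integral are monotone: the integral of a
nonnegative function is a supremum over the simple functions below it. In this
generality the comparison applies to gradients, whose measurability in the added
point is not obvious, and to [f * ln f], which may fail to be integrable. *)
Lemma le_integral_pointwise dT (T : measurableType dT) (R : realType)
    (Q : {measure set T -> \bar R}) (f g : T -> \bar R) :
  (forall x, f x <= g x)%E -> (\int[Q]_x f x <= \int[Q]_x g x)%E.
Proof.
move=> fg.
have nn (u v : T -> \bar R) : (forall x, 0 <= u x)%E -> (forall x, 0 <= v x)%E ->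
    (forall x, u x <= v x)%E -> (\int[Q]_x u x <= \int[Q]_x v x)%E.
  move=> u0 v0 uv; rewrite !ge0_integralTE//; apply: ereal_sup_le => _ [h hu <-].
  by exists h => // x; exact: le_trans (hu x) (uv x).
rewrite [leLHS]integralE [leRHS]integralE; apply: leeB; apply: nn => // x.
- by apply: (@funepos_le _ _ setT) => [y _|]; rewrite ?inE.
- by apply: (@funeneg_le _ _ setT) => [y _|]; rewrite ?inE.
Qed.

(** Fenchel-Young inequality for the conjugate pair [x * ln x - x] and [expR y];
it is the tangent inequality [1 + z <= expR z] at [z = y - ln x]. *)
Lemma young_expR (R : realType) (x y : R) :
  0 <= x -> x * y - expR y + x <= x * ln x.
Proof.
rewrite le_eqVlt => /predU1P[<-|x0].
  by rewrite !mul0r add0r addr0 oppr_le0 expR_ge0.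
have := expR_ge1Dx (y - ln x).
rewrite expRB lnK ?posrE// ler_pdivlMr// => h.
nra.
Qed.

(** Lower bound in the Gibbs variational principle, for a test function
[G = a * (\sum_k \1_(A k)) - b] normalised by the integral of [expR G] being at
most 1. With [f] the density, integrate Young's inequality
[f * G - expR G + f <= f * ln f] and use that [f] has integral 1. For such
simple [G] the integral of [f * G] is read off directly from the values
[P (A k)]. *)
Lemma gibbs_inequality dT (T : measurableType dT) (R : realType)
    (P Q : probability T R) (K : finType) (A : K -> set T) (a b : R) :
  (forall k, measurable (A k)) ->
  (\int[Q]_x (expR (a * (\sum_k \1_(A k) x) - b))%:E <= 1)%E ->
  ((a * (\sum_k fine (P (A k))) - b)%:E <= relative_entropy P Q)%E.
Proof.
move=> mA expG1; rewrite /relative_entropy.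
case: pselect => [ex|_]; last by rewrite leey.
case: (cid ex) => f [mf f0 PE] /=.
set G := fun x => a * (\sum_k \1_(A k) x) - b.
have mG : measurable_fun [set: T] G.
  apply: measurable_funB => //; apply: measurable_funM => //.
  by apply: measurable_sum => k; exact: measurable_indic.
pose E x := expR (G x).
have mE : measurable_fun [set: T] E by exact: measurableT_comp.
have iE : Q.-integrable setT (EFin \o E).
  apply/integrableP; split; first exact/measurable_EFinP.
  apply: le_lt_trans (ltry 1); apply: le_trans expG1.
  by apply: le_integral_pointwise => x /=; rewrite ger0_norm ?expR_ge0.
have intf : (\int[Q]_x (f x)%:E = 1)%E.
  by rewrite -PE//; exact: probability_setT.
have if_ : Q.-integrable setT (EFin \o f).
  apply/integrableP; split; first exact/measurable_EFinP.
  apply: le_lt_trans (ltry 1); rewrite -intf.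
  by apply: le_integral_pointwise => x /=; rewrite ger0_norm.
have fA k : (\int[Q]_x (f x * \1_(A k) x)%:E = P (A k))%E.
  rewrite PE// [RHS]integral_mkcond; apply: eq_integral => x _.
  by rewrite /patch indicE; case: ifP => _; rewrite ?mulr1 ?mulr0.
have iA k : Q.-integrable setT (EFin \o (fun x => f x * \1_(A k) x)).
  apply/integrableP; split.
    by apply/measurable_EFinP/measurable_funM => //; exact: measurable_indic.
  apply: le_lt_trans (ltry 1); rewrite -intf.
  apply: le_integral_pointwise => x /=.
  by rewrite ger0_norm ?mulr_ge0//= lee_fin ler_piMr.
have iS : Q.-integrable setT (fun x => \sum_k (f x * \1_(A k) x)%:E)%E.
  by apply: integrable_sum => // k _; exact: iA.
have PA k : (P (A k)) = (fine (P (A k)))%:E by rewrite fineK// fin_num_measure.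
apply: (@le_trans _ _ (\int[Q]_x
    (a%:E * (\sum_k (f x * \1_(A k) x)%:E) + (1 - b)%:E * (f x)%:E - (E x)%:E))%E).
  have i1 := integrableZl measurableT a iS.
  have i2 := integrableZl measurableT (1 - b) if_.
  rewrite integralB//; last exact: integrableD.
  rewrite integralD// integralZl// integralZl// integral_sum//.
  rewrite (eq_bigr (fun k => (fine (P (A k)))%:E)) => [|k _]; last first.
    by rewrite -PA -fA.
  rewrite intf mule1 sumEFin -EFinM -EFinD.
  apply: (@le_trans _ _ ((a * (\sum_k fine (P (A k))) + (1 - b))%:E - 1)%E).
    by rewrite -EFinB lee_fin; lra.
  exact: leeB.
apply: le_integral_pointwise => x.
rewrite sumEFin -2!EFinM -EFinD lee_fin -mulr_sumr.
apply: le_trans (young_expR (G x) (f0 x)).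
by rewrite /E /G; lra.
Qed.

(** * Local events and their translates *)

Section local_events.
Context (R : realType) (d : nat).
Implicit Types (Lam : set 'rV[R]_d) (A : set (config R d)).

(** The sub-sigma-algebra of events that depend on the configuration in [Lam]
only, seen as a set of events of the full configuration space. *)
Definition local_event Lam : set (set (config R d)) :=
  @measurable _ (config_on Lam).

Lemma local_event_measurable Lam A : local_event Lam A -> measurable A.
Proof. exact: sub_counting_events. Qed.

Lemma local_eventS Lam Lam' : Lam `<=` Lam' ->
  local_event Lam `<=` local_event Lam'.
Proof.
move=> LL; apply: sub_sigma_algebra2 => _ [D [B [bD mD DL ->]]].
by exists D, B; split => //; exact: subset_trans LL.
Qed.

(** The events unchanged by restricting the configuration to [Lam] form a
sigma-algebra, and it contains the counting events of subsets of [Lam]. *)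
Lemma local_event_restrict Lam A : local_event Lam A ->
  config_restrict Lam @^-1` A = A.
Proof.
move: A; apply: smallest_sub; first split.
- exact: preimage_set0.
- by move=> A /= AE; rewrite setTD -preimage_setC AE.
- by move=> F FE; rewrite preimage_bigcup; apply: eq_bigcupr => i _; exact: FE.
move=> _ [D [B [_ _ DL ->]]]; apply/funext => w /=.
by rewrite /counting_var /= -setIA (setIidr DL).
Qed.

(** This is the translate [Lam + x], written as a preimage so that measurability
follows from that of [fun y => y - x]. *)
Definition shift_preimage (x : 'rV[R]_d) Lam := (fun y => y - x) @^-1` Lam.

Lemma measurable_shift_preimage x Lam :
  measurable Lam -> measurable (shift_preimage x Lam).
Proof.
move=> mL; rewrite /shift_preimage -[X in measurable X]setTI.
suff m : measurable_fun [set: 'rV[R]_d] (fun y : 'rV[R]_d => y - x) by exact: m.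
apply: measurable_fun_rVP => i.
under eq_fun do rewrite !mxE.
by apply: measurable_funB => //; exact: measurable_rV_coord.
Qed.

Lemma bounded_shift_preimage x Lam :
  bounded_set Lam -> bounded_set (shift_preimage x Lam).
Proof.
move=> [M [Mr HM]]; exists (M + `|x|); split; first by rewrite num_real.
move=> r Mr' y /= Ly; rewrite -(subrK x y) (le_trans (ler_normD _ _))//.
rewrite -lerBrDr; apply: HM => //.
by rewrite ltrBrDr.
Qed.

Lemma counting_var_translate x Lam (w : config R d) : bounded_set Lam ->
  counting_var Lam (config_translate x w) = counting_var (shift_preimage x Lam) w.
Proof.
move=> bL; rewrite /counting_var.
have fw := config_locally_finite w (@bounded_shift_preimage x _ bL).
have -> : config_translate x w `&` Lam =
    (fun y => y - x) @` (w `&` shift_preimage x Lam).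
  apply/seteqP; split => [_ [[y wy <-] Ly]|_ [y [wy Ly] <-]].
    by exists y.
  by split => //; exists y.
by rewrite fset_set_image// card_imfset//=; exact: addIr.
Qed.

(** Translating by [x] moves a point of [Lam + x] into [Lam], so the count in
[D] after translation is the count in [D + x] before; it suffices to check
this on counting events. *)
Lemma local_event_translate x Lam A : local_event Lam A ->
  local_event (shift_preimage x Lam) (config_translate x @^-1` A).
Proof.
move=> LA; rewrite -[_ @^-1` _]setTI.
suff m : measurable_fun [set: config_on (shift_preimage x Lam)]
   (config_translate x : config_on (shift_preimage x Lam) -> config_on Lam).
  exact: m.
apply: (@measurability _ _ _ (config_on Lam) _ _ (counting_events Lam)) => //.
move=> _ [_ [D [B [bD mD DL ->]]] <-]; rewrite setTI; apply: sub_sigma_algebra.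
exists (shift_preimage x D), B; split.
- exact: bounded_shift_preimage.
- exact: measurable_shift_preimage.
- by move=> y /= /DL.
- by apply/funext => w /=; rewrite counting_var_translate.
Qed.

Lemma cubeS m n : (m <= n)%N -> cube R d m `<=` cube R d n.
Proof.
move=> mn x xm i; move: (xm i) => /andP[a b].
have mnR : m%:R <= n%:R :> R by rewrite ler_nat.
by apply/andP; split; lra.
Qed.

Lemma measurable_cube n : measurable (cube R d n).
Proof.
rewrite (_ : cube R d n = \bigcap_(i in [set: 'I_d]) ((fun x : 'rV[R]_d =>
   x 0 i) @^-1` `[- n%:R, n%:R]%classic)).
  apply: fin_bigcap_measurable => // i _; rewrite -[X in measurable X]setTI.
  exact: measurable_rV_coord.
apply/seteqP; split=> x /= H i.
  by move=> _ /=; rewrite in_itv/=; exact: H.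
by have := H i Logic.I; rewrite /= in_itv.
Qed.

Lemma norm_rV_le (x : 'rV[R]_d) (r : R) : 0 <= r ->
  (`|x| <= r) <-> (forall i, `|x 0 i| <= r).
Proof.
move=> r0; rewrite [X in (X <= r) <-> _]/Num.Def.normr /= mx_normrE.
split=> [/bigmax_leP[_ H] i|H]; first exact: (H (0, i)).
by apply/bigmax_leP; split=> // -[j i] _ /=; rewrite (ord1 j).
Qed.

Lemma bounded_cube n : bounded_set (cube R d n).
Proof.
exists n%:R; split; first by rewrite num_real.
move=> r nr x xn; apply/norm_rV_le => [|i]; first by rewrite ltW// (le_lt_trans _ nr).
by rewrite ler_norml; move: (xn i) => /andP[a b]; apply/andP; split; lra.
Qed.

Lemma bounded_sub_cube Lam : bounded_set Lam -> exists n, Lam `<=` cube R d n.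
Proof.
move=> [M [Mr HM]].
have /HM MB : M < (Num.truncn `|M|).+1%:R.
  by rewrite (le_lt_trans (ler_norm _))// truncnS_gt.
exists (Num.truncn `|M|).+1 => x /MB /norm_rV_le H i.
by rewrite -ler_norml; exact: H.
Qed.

Lemma shift_cube x m : shift_preimage x (cube R d m) =
  [set y | forall i, x 0 i - m%:R <= y 0 i <= x 0 i + m%:R].
Proof.
apply/seteqP; split=> y /= H i; have := H i; rewrite !mxE => /andP[a b];
  by apply/andP; split; lra.
Qed.

Lemma lebesgue_shift_cube x m :
  lebesgue_rV R d (shift_preimage x (cube R d m)) = ((m%:R *+ 2) ^+ d)%:E.
Proof.
rewrite shift_cube lebesgue_rV_box => [|i]; last first.
  have : 0 <= m%:R :> R by []. lra.
rewrite (eq_bigr (fun=> m%:R *+ 2)) => [|i _]; last by rewrite mulr2n; lra.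
by rewrite prodr_const card_ord.
Qed.

Lemma lebesgue_cube m : lebesgue_rV R d (cube R d m) = ((m%:R *+ 2) ^+ d)%:E.
Proof.
rewrite -(lebesgue_shift_cube 0) /shift_preimage.
by congr (lebesgue_rV R d _); apply/funext => y /=; rewrite subr0.
Qed.

(** The events local to some cube form a pi-system, because the cubes increase,
and they generate the full sigma-algebra, because every bounded set lies in a
cube. *)
Lemma config_measure_ext (mu nu : probability (config R d) R) :
  (forall m A, local_event (cube R d m) A -> mu A = nu A) ->
  forall A, measurable A -> mu A = nu A.
Proof.
move=> H; apply: (@measure_unique _ _ _
   [set A | exists m, local_event (cube R d m) A] (fun=> setT)) => //.
- apply/seteqP; split.
    apply: sub_sigma_algebra2 => _ [D [B [bD mD _ ->]]].
    have [m Dm] := bounded_sub_cube bD; exists m.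
    by apply: sub_sigma_algebra; exists D, B.
  apply: smallest_sub; first exact: sigma_algebra_measurable.
  by move=> A [m /local_event_measurable].
- move=> A B [m mA] [n nB]; exists (maxn m n).
  by apply: (@measurableI _ (config_on (cube R d (maxn m n))));
    [apply: local_eventS mA|apply: local_eventS nB]; apply: cubeS;
    rewrite ?leq_maxl ?leq_maxr.
- by move=> _; exists 0%N; exact: (@measurableT _ (config_on _)).
- by rewrite bigcup_const.
- by move=> A [m mA]; exact: H mA.
- by move=> _; rewrite -ge0_fin_numE// fin_num_measure.
Qed.

(** Passing to the complement of an event swaps the two strict inequalities, so
a local event charged more by [mu] than by [nu] always exists. The index
[m.+1] makes the cube have positive volume. *)
Lemma exists_local_event_gt (mu nu : probability (config R d) R) :
  ~ (forall A, measurable A -> mu A = nu A) ->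
  exists m, exists2 A, local_event (cube R d m.+1) A &
    fine (nu A) < fine (mu A).
Proof.
move=> neq; apply: contra_notP neq => nex; apply: config_measure_ext => m A mA.
have {}mA : local_event (cube R d m.+1) A by apply: local_eventS mA; exact: cubeS.
have le B : local_event (cube R d m.+1) B -> fine (mu B) <= fine (nu B).
  by move=> mB; rewrite leNgt; apply/negP => lt; apply: nex; exists m, B.
have fE (P : probability (config R d) R) B : local_event (cube R d m.+1) B ->
    (fine (P B))%:E = P B.
  by move=> /local_event_measurable mB; rewrite fineK// fin_num_measure.
have mAC : local_event (cube R d m.+1) (~` A).
  exact: (@measurableC _ (config_on _)).
have fC (P : probability (config R d) R) : fine (P (~` A)) = 1 - fine (P A).
  rewrite (probability_setC P); last exact: local_event_measurable mA.
  by rewrite fineB// fin_num_measure//; exact: local_event_measurable mA.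
rewrite -(fE mu)// -(fE nu)//; congr (_%:E); apply/eqP; rewrite eq_le le//=.
by have := le _ mAC; rewrite !fC; lra.
Qed.

End local_events.

(** * Counting local events in disjoint sets *)

Section disjoint_local_events.
Context (R : realType) (d : nat) (K : finType).
Variables (C : K -> set 'rV[R]_d) (A : K -> set (config R d)).
Hypothesis disjC : forall k l x, C k x -> C l x -> k = l.
Hypothesis locA : forall k, local_event (C k) (A k).

Definition event_count (eta : config R d) : R := \sum_k \1_(A k) eta.

Lemma event_count_measurable : measurable_fun setT event_count.
Proof.
apply: measurable_sum => k; apply: measurable_indic.
exact: local_event_measurable (@locA k).
Qed.

Lemma event_count_ge0 eta : 0 <= event_count eta.
Proof. by apply: sumr_ge0 => k _; rewrite indicE. Qed.

Lemma event_count_le eta : event_count eta <= #|K|%:R.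
Proof.
rewrite -sum1_card natr_sum; apply: ler_sum => k _.
by rewrite indicE; case: (_ \in _).
Qed.

Lemma event_count_is_local (Lam : set 'rV[R]_d) : bounded_set Lam -> measurable Lam ->
  (forall k, C k `<=` Lam) -> is_local event_count.
Proof.
move=> bL mL CL; split; first exact: event_count_measurable.
exists Lam; split => // eta; apply: eq_bigr => k _.
have locL : local_event Lam (A k) by exact: local_eventS (@locA k).
by rewrite -[in LHS](local_event_restrict locL).
Qed.

Lemma bounded_event_count : bounded_fun event_count.
Proof.
exists #|K|%:R; split; first by rewrite num_real.
move=> r /ltW Kr eta _ /=.
by rewrite ger0_norm ?event_count_ge0// (le_trans (event_count_le eta)).
Qed.

(** Adding a point outside [C k] does not affect the indicator of [A k], and
adding one inside changes it by at most 1. *)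
Lemma gradient_event_count x eta :
  `|gradient x event_count eta| <= \sum_k \1_(C k) x.
Proof.
rewrite /gradient -sumrB (le_trans (ler_norm_sum _ _ _))//.
apply: ler_sum => k _; rewrite [leRHS]indicE.
have [_|/negP xC] := boolP (x \in C k).
  by rewrite !indicE; case: (_ \in A k); case: (_ \in A k);
    rewrite /= ?subrr ?normr0 ?subr0 ?sub0r ?normrN ?normr1 ?ler01.
rewrite !indicE.
have -> : (config_add x eta \in A k) = (eta \in A k); last by rewrite subrr normr0.
rewrite -(local_event_restrict (@locA k)) /preimage.
suff H : config_restrict (C k) (config_add x eta) = config_restrict (C k) eta.
  by apply/idP/idP; rewrite !inE /= H.
apply: config_eq; apply/seteqP; split=> y /= [xy Cy]; split=> //; last by right.
by case: xy => // yx; case: xC; rewrite inE -yx.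
Qed.

Lemma sum_indic_disjoint_le1 x : \sum_k \1_(C k) x <= 1 :> R.
Proof.
have [[k Ckx]|nC] := pselect (exists k, C k x); last first.
  rewrite big1 // => k _; rewrite indicE memNset// => Ckx.
  by apply: nC; exists k.
rewrite (bigD1 k)//= big1 ?addr0 => [|l lk]; first by rewrite indicE; case: (_ \in _).
rewrite indicE memNset// => Clx; move/eqP: lk; apply.
exact: disjC Clx Ckx.
Qed.

(** Disjointness makes [\sum_k \1_(C k)] an indicator; it bounds the modulus of
the gradient, hence also its square. The squared norm therefore grows only
linearly with the number of events. *)
Lemma integral_gradient_event_count eta (V : R) :
  (forall k, measurable (C k)) -> (forall k, lebesgue_rV R d (C k) = V%:E) ->
  (\int[lebesgue_rV R d]_x (`|gradient x event_count eta| ^+ 2)%:E <=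
    (#|K|%:R * V)%:E)%E.
Proof.
move=> mC CV.
apply: (@le_trans _ _ (\int[lebesgue_rV R d]_x \sum_k (\1_(C k) x)%:E)%E).
  apply: le_integral_pointwise => x; rewrite sumEFin lee_fin.
  apply: le_trans (gradient_event_count x eta).
  rewrite expr2 ler_piMr// (le_trans (gradient_event_count x eta))//.
  exact: sum_indic_disjoint_le1.
rewrite ge0_integral_sum// => [|k].
  rewrite (eq_bigr (fun=> V%:E)) => [|k _]; last first.
    by rewrite integral_indic// setIT; exact: CV.
  by rewrite sumEFin lee_fin sumr_const mulr_natl.
by apply/measurable_EFinP; exact: measurable_indic.
Qed.

Lemma expectation_event_count (P : probability (config R d) R) :
  ('E_P[event_count] = (\sum_k fine (P (A k)))%:E)%E.
Proof.
have mA k : measurable (A k) by exact: local_event_measurable (@locA k).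
rewrite unlock; under eq_integral do rewrite -sumEFin.
rewrite ge0_integral_sum// => [|k].
  rewrite -sumEFin; apply: eq_bigr => k _.
  by rewrite integral_indic// setIT fineK// fin_num_measure.
by apply/measurable_EFinP; exact: measurable_indic.
Qed.

Lemma event_count_measurable_on Lam : (forall k, C k `<=` Lam) ->
  measurable_fun [set: config_on Lam] event_count.
Proof.
move=> CL; apply: measurable_sum => k; apply: measurable_indic.
by have : local_event Lam (A k) by exact: local_eventS (@locA k).
Qed.

(** The restricted measure is the image of [P] under the identity, which is
measurable towards the smaller sigma-algebra. *)
Lemma integral_measure_restrict Lam (P : probability (config R d) R)
    (g : config_on Lam -> \bar R) :
  measurable_fun [set: config_on Lam] g -> (forall x, 0 <= g x)%E ->
  (\int[measure_restrict Lam P]_x g x = \int[P]_x g x)%E.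
Proof.
move=> mg g0.
have mid : measurable_fun [set: config R d] (fun x : config R d => (x : config_on Lam)).
  by move=> _ B mB; rewrite setTI; exact: sub_counting_events mB.
have := ge0_integral_pushforward mid P measurableT mg (fun x _ => g0 x).
by rewrite preimage_setT.
Qed.

(** Gibbs inequality against the concentration inequality for [event_count].
The gradient is at most [beta = 1] and its squared norm at most
[alpha ^+ 2 = #|K|%:R * V], so both the gain and the loss are proportional to the
number of events; the loss is of second order in [lambda]. *)
Lemma entropy_ge_event_count (Lam : set 'rV[R]_d) (V c lambda : R)
    (mu nu : probability (config R d) R) :
  MGF_CI c nu -> bounded_set Lam -> measurable Lam -> (forall k, C k `<=` Lam) ->
  (forall k, measurable (C k)) -> (forall k, lebesgue_rV R d (C k) = V%:E) ->
  0 < V -> (0 < #|K|)%N -> 0 < lambda ->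
  ((lambda * (\sum_k (fine (mu (A k)) - fine (nu (A k)))) -
     c * (#|K|%:R * V) * lambda * (expR lambda - 1))%:E <=
   relative_entropy (measure_restrict Lam mu) (measure_restrict Lam nu))%E.
Proof.
move=> mgf bL mL CL mC CV V0 K0 l0.
have KV0 : 0 < #|K|%:R * V by rewrite mulr_gt0// ltr0n.
set D := c * _ * _ * _.
set S := \sum_k fine (nu (A k)).
have mgfF : (\int[nu]_x (expR (lambda * (event_count x - S)))%:E <= (expR D)%:E)%E.
  rewrite (_ : integral _ _ _ =
      'E_nu[fun x => expR (lambda * (event_count x - S))])%E; last first.
    by rewrite expectation.unlock.
  have := mgf (Num.sqrt (#|K|%:R * V)) 1 lambda event_count.
  rewrite sqr_sqrtr ?(ltW KV0)// expectation_event_count mul1r divr1.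
  apply => //.
  - exact: event_count_is_local CL.
  - exact: bounded_event_count.
  - apply: aeW => -[eta x] /=; rewrite (le_trans (ler_norm _))//.
    by rewrite (le_trans (gradient_event_count _ _))// sum_indic_disjoint_le1.
  - by apply: aeW => eta; exact: integral_gradient_event_count.
have mE (b : R) : measurable_fun [set: config_on Lam]
    (fun x => (expR (lambda * event_count x - b))%:E).
  apply/measurable_EFinP; apply: measurableT_comp => //.
  apply: measurable_funB => //; apply: measurable_funM => //.
  exact: event_count_measurable_on.
have := @gibbs_inequality _ _ R (measure_restrict Lam mu) (measure_restrict Lam nu)
  K A lambda (lambda * S + D).
rewrite -/(event_count _); move=> gibbs.
rewrite sumrB mulrBr -addrA -opprD; apply: gibbs.
  by move=> k; have : local_event Lam (A k) by exact: local_eventS (@locA k).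
rewrite (@integral_measure_restrict Lam nu (fun x =>
    (expR (lambda * event_count x - (lambda * S + D)))%:E));
  [|exact: mE|by move=> x; rewrite lee_fin expR_ge0].
under eq_integral do rewrite opprD addrA -mulrBr expRD mulrC EFinM.
rewrite ge0_integralZl_EFin ?expR_ge0//; last first.
  apply/measurable_EFinP; apply: measurableT_comp => //.
  apply: measurable_funM => //; apply: measurable_funB => //.
  exact: event_count_measurable.
apply: (@le_trans _ _ ((expR (- D))%:E * (expR D)%:E)%E).
  by rewrite lee_pmul2l// ?lte_fin ?expR_gt0// lee_fin.
by rewrite -EFinM -expRD addNr expR0.
Qed.

End disjoint_local_events.

(** * Lattices of disjoint cubes *)

Section lattice.
Context (R : realType) (d m N : nat).

(** The spacing [m.*2.+1] exceeds the side [m.*2] of the closed cube of index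
[m], so that the cubes centred at the lattice points are pairwise disjoint. Only
points of the positive orthant are used: this loses a factor [2 ^+ d] in their
number, which is harmless. *)
Definition lattice_point (k : {ffun 'I_d -> 'I_N}) : 'rV[R]_d :=
  \row_i (m.*2.+1 * k i)%:R.

Lemma lattice_cubes_disjoint (k l : {ffun 'I_d -> 'I_N}) (x : 'rV[R]_d) :
  shift_preimage (lattice_point k) (cube R d m) x ->
  shift_preimage (lattice_point l) (cube R d m) x -> k = l.
Proof.
rewrite !shift_cube => xk xl; apply/ffunP => i; apply: val_inj => /=.
move: (xk i) (xl i); rewrite !mxE => /andP[a b] /andP[a' b'].
have mm : m.*2%:R = m%:R + m%:R :> R by rewrite -addnn natrD.
have kl : ((m.*2.+1 * k i)%:R : R) <= (m.*2.+1 * l i + m.*2)%:R.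
  by rewrite natrD mm; lra.
have lk : ((m.*2.+1 * l i)%:R : R) <= (m.*2.+1 * k i + m.*2)%:R.
  by rewrite natrD mm; lra.
move: kl lk; rewrite !ler_nat; nia.
Qed.

Lemma lattice_cubes_sub n (k : {ffun 'I_d -> 'I_N}) : (N * m.*2.+1 <= n)%N ->
  shift_preimage (lattice_point k) (cube R d m) `<=` cube R d n.
Proof.
move=> Nn; rewrite shift_cube => x xk i; move: (xk i) => /=.
rewrite mxE => /andP[a b].
have kN : ((m.*2.+1 * k i + m)%:R : R) <= n%:R.
  by rewrite ler_nat; have := ltn_ord (k i); nia.
have k0 : 0 <= ((m.*2.+1 * k i)%:R : R) by rewrite ler0n.
have mn : (m%:R : R) <= n%:R.
  by rewrite ler_nat; have := ltn_ord (k i); nia.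
by rewrite natrD in kN; apply/andP; split; lra.
Qed.

End lattice.

(** By stationarity all translates of [A] have the same probability, under [mu]
as under [nu], so the differences add up over the [N ^ d] lattice points. *)
Lemma entropy_ge_lattice (R : realType) d (mu nu : probability (config R d) R)
    (c lambda : R) (m N n : nat) (A : set (config R d)) :
  stationary mu -> stationary nu -> MGF_CI c nu ->
  local_event (cube R d m) A -> (0 < m)%N -> (0 < N)%N ->
  (N * m.*2.+1 <= n)%N -> 0 < lambda ->
  ((N%:R ^+ d * (lambda * (fine (mu A) - fine (nu A) -
      c * (m%:R *+ 2) ^+ d * (expR lambda - 1))))%:E <=
   relative_entropy (measure_restrict (cube R d n) mu)
                    (measure_restrict (cube R d n) nu))%E.
Proof.
move=> smu snu mgf locA m0 N0 Nn l0.
have mA := local_event_measurable locA.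
have cK : #|{ffun 'I_d -> 'I_N}|%:R = N%:R ^+ d :> R.
  by rewrite card_ffun !card_ord natrX.
have K0 : (0 < #|{ffun 'I_d -> 'I_N}|)%N by rewrite card_ffun !card_ord expn_gt0 N0.
have V0 : 0 < ((m%:R *+ 2) ^+ d : R) by rewrite exprn_gt0// mulrn_wgt0// ltr0n.
have := @entropy_ge_event_count R d {ffun 'I_d -> 'I_N}
  (fun k => shift_preimage (lattice_point R m k) (cube R d m))
  (fun k => config_translate (lattice_point R m k) @^-1` A)
  (@lattice_cubes_disjoint R d m N)
  (fun k => local_event_translate (x := lattice_point R m k) locA)
  (cube R d n) _ c lambda mu nu mgf (@bounded_cube R d n) (@measurable_cube R d n)
  (fun k => @lattice_cubes_sub R d m N n k Nn)
  (fun k => @measurable_shift_preimage R d (lattice_point R m k) _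
     (@measurable_cube R d m))
  (fun k => @lebesgue_shift_cube R d _ m) V0 K0 l0.
apply: le_trans.
rewrite (eq_bigr (fun=> fine (mu A) - fine (nu A))) => [|k _]; last first.
  by rewrite smu// snu.
rewrite sumr_const -[_ *+ #|_|]mulr_natl cK lee_fin le_eqVlt; apply/orP; left.
by apply/eqP; set X := _ ^+ d; set Y := _ ^+ d; ring.
Qed.

(** * Positivity of the specific entropy *)

Lemma limn_einf_ge (R : realType) (u : (\bar R)^nat) (a : \bar R) n0 :
  (forall n, (n0 <= n)%N -> (a <= u n)%E) -> (a <= limn_einf u)%E.
Proof.
move=> au; rewrite limn_einf_lim; apply: lime_ge; first exact: is_cvg_einfs.
exists n0 => // n /= nn0; apply: le_ereal_inf_tmp => _ [k /= nk <-].
by apply: au; exact: leq_trans nk.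
Qed.

Theorem proposition1p9 (R : realType) (d : nat) (nu : probability (config R d) R)
    (c_nu : R) :
  (0 < d)%N -> stationary nu -> 0 < c_nu -> MGF_CI c_nu nu ->
  forall mu : probability (config R d) R, stationary mu ->
    ~ (forall A : set (config R d), measurable A -> mu A = nu A) ->
    (0 < specific_entropy mu nu)%E.
Proof.
move=> _ snu c0 mgf mu smu neq.
have [m [A locA gtA]] := exists_local_event_gt neq.
set delta := fine (mu A) - fine (nu A).
have d0 : 0 < delta by rewrite subr_gt0.
set V : R := (m.+1%:R *+ 2) ^+ d.
have V0 : 0 < V by rewrite exprn_gt0// mulrn_wgt0// ltr0n.
(* With this choice of lambda the concentration loss uses up exactly half of
   the gain delta. *)
pose r := delta / (2 * (c_nu * V)).
have r0 : 0 < r by rewrite divr_gt0// mulr_gt0// mulr_gt0.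
pose lambda := ln (1 + r).
have l0 : 0 < lambda by rewrite ln_gt0// ltrDl.
have gain : delta - c_nu * V * (expR lambda - 1) = delta / 2.
  have -> : expR lambda - 1 = r by rewrite lnK ?posrE ?addr_gt0//; ring.
  by rewrite /r; field; rewrite !gt_eqF.
set s := m.+1.*2.+1.
(* Once n >= s, the n %/ s lattice points per axis satisfy
   2 * n <= 4 * s * (n %/ s), which is where the constant 4 * s comes from. *)
pose a := lambda * (delta / 2) / (4 * s%:R) ^+ d.
have a0 : 0 < a by rewrite divr_gt0 ?mulr_gt0 ?divr_gt0// exprn_gt0// mulr_gt0.
apply: (@lt_le_trans _ _ a%:E); first by rewrite lte_fin.
apply: (@limn_einf_ge _ _ _ s) => n sn.
have n0 : (0 < n)%N by exact: leq_trans sn.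
have N0 : (0 < n %/ s)%N by rewrite divn_gt0.
have := entropy_ge_lattice smu snu mgf locA (ltn0Sn m) N0 (leq_trunc_div n s) l0.
rewrite -/delta -/V gain => ent.
have W0 : 0 < (n%:R *+ 2 : R) ^+ d by rewrite exprn_gt0// mulrn_wgt0// ltr0n.
rewrite lebesgue_cube inver gt_eqF//.
apply: (@le_trans _ _ (((n %/ s)%:R ^+ d * (lambda * (delta / 2)))%:E *
    (((n%:R *+ 2) ^+ d)^-1)%:E)%E); last first.
  by rewrite lee_wpmul2r// lee_fin invr_ge0 ltW.
rewrite -EFinM lee_fin ler_pdivlMr// /a mulrAC ler_pdivrMr; last first.
  by rewrite exprn_gt0// mulr_gt0.
rewrite [leRHS]mulrAC mulrC ler_wpM2r//.
  by rewrite mulr_ge0 ?divr_ge0// ltW.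
rewrite -exprMn; apply: lerXn2r; rewrite ?nnegrE ?mulrn_wge0 ?mulr_ge0//.
rewrite -mulr_natl -!natrM ler_nat.
have := ltn_ceil n (ltn0Sn m.+1.*2); rewrite -/s; nia.
Qed.
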